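(* Let $R$ be a finite $G$-rack which has $c$ orbits. Then the order complex of $\overline{\mathcal{R}(R)}=\mathcal{R}(R)\setminus\{\emptyset,R\}$ has the homotopy type of the $(c-2)$-dimensional sphere $S^{c-2}$.
   Context: A rack is a set $R$ with a binary operation $\triangleright$ such that $a\triangleright(b\triangleright c)=(a\triangleright b)\triangleright(a\triangleright c)$ for all $a,b,c\in R$, and for all $a,b\in R$ there is a unique $x\in R$ with $a\triangleright x=b$. A subrack is a subset $Q$ with $(Q,\triangleright)$ a rack (including $\emptyset$). $\mathcal{R}(R)$ is the poset of subracks ordered by inclusion. For $a\in R$, $f_a(b)=a\triangleright b$; $\mathrm{Inn}(R)$ is the group generated by the $f_a$, and the orbits of $R$ are the orbits of $\mathrm{Inn}(R)$ on $R$. $R$ is a $G$-rack if $R$ is the only subrack of $R$ meeting every orbit of $R$. The order complex of a poset $P$ is the simplicial complex whose faces are the finite chains of $P$. *)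

(* Defs.v *)
From HB Require Import structures.
From mathcomp Require Import all_boot all_order all_fingroup all_algebra.
From mathcomp Require Import all_classical all_reals all_analysis.
Import Order.TTheory GRing.Theory Num.Theory.
Import numFieldNormedType.Exports.
(* Orders [{set T}] by inclusion. *)
Import Order.DefaultSetSubsetOrder.

Set Implicit Arguments.
Unset Strict Implicit.
Unset Printing Implicit Defensive.

Local Open Scope classical_set_scope.
Local Open Scope ring_scope.

Section Racks.
Context (T : finType) (op : T -> T -> T).

Definition is_rack_on (Q : {set T}) : Prop :=
  [/\ forall a b, a \in Q -> b \in Q -> op a b \in Q,
      forall a b c, a \in Q -> b \in Q -> c \in Q ->
        op a (op b c) = op (op a b) (op a c)
    & forall a b, a \in Q -> b \in Q ->
        exists! x, x \in Q /\ op a x = b].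

Definition is_rack : Prop := is_rack_on [set: T]%SET.

Definition is_subrack (Q : {set T}) : Prop := is_rack_on Q.

(* In a rack every left translation [op a] is a permutation, so the generating
   set below is exactly the set of all left translations. *)
Definition Inn : {set {perm T}} :=
  <<[set s : {perm T} | [exists a, [forall b, s b == op a b]]]%SET>>%g.

Definition rack_orbits : {set {set T}} :=
  [set orbit 'P Inn x | x : T]%SET.

Definition is_G_rack : Prop :=
  is_rack /\
  forall Q : {set T}, is_subrack Q ->
    (forall O : {set T}, O \in rack_orbits -> (Q :&: O)%SET != finset.set0) ->
    Q = [set: T]%SET.

Definition proper_subracks : {set {set T}} :=
  [set Q : {set T} |
     [&& `[< is_subrack Q >], Q != finset.set0 & Q != [set: T]%SET]]%SET.

End Racks.

(* The family includes the empty chain, which has no effect on [realization]. *)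
Definition order_complex (d : Order.disp_t) (V : finPOrderType d)
    (P : {set V}) : {set {set V}} :=
  [set s : {set V} |
     (s \subset P) && [forall u in s, forall v in s, (u >=< v)%O]]%SET.

Definition subrack_complex (T : finType) (op : T -> T -> T)
    : {set {set {set T}}} :=
  order_complex (proper_subracks op).

(* Barycentric coordinates, with the topology inherited from R^V. *)
Definition realization (R : realType) (V : finType) (K : {set {set V}})
    : topologicalType :=
  [set x : {ptws V -> (R : topologicalType)} |
     [/\ forall v, 0 <= (x v : R),
         \sum_v (x v : R) = 1
       & [set v | (x v : R) != 0]%SET \in K]].

(* The unit sphere S^(n-1) of R^n; it is empty for n = 0. *)
Definition unit_sphere (R : realType) (n : nat) : topologicalType :=
  [set x : 'rV[R]_n | \sum_i (x ord0 i) ^+ 2 = 1].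

Definition homotopic (R : realType) (X Y : topologicalType) (f g : X -> Y)
    : Prop :=
  exists H : R * X -> Y,
    [/\ {within `[0, 1] `*` setT, continuous H},
        forall x, H (0, x) = f x
      & forall x, H (1, x) = g x].

Definition homotopy_equivalent (R : realType) (X Y : topologicalType) : Prop :=
  exists (f : X -> Y) (g : Y -> X),
    [/\ continuous f, continuous g,
        homotopic R (g \o f) idfun & homotopic R (f \o g) idfun].

(* Main.v *)
(* Let O_0, ..., O_n be the orbits, n + 1 = c. A set Q of elements of the rack
   has a trace s(Q), the set of i such that Q meets O_i, and a set A of indices
   has a union t(A) of orbits, which is a subrack. Since R is a G-rack, s and t
   restrict to the proper nonempty subracks and the proper nonempty index sets,
   with s t = id and Q <= t (s Q): thus t s is a closure operator, and its image
   is the proper part of a Boolean lattice, whose realization is a sphere.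

   The homotopy equivalence is explicit. A point x of the realization has the
   height function u_i = sum of x_Q over the Q that meet O_i; it is not
   constant, and (u_i - u_0)_(i > 0), normalized, is a point of the sphere.
   Conversely, a nonconstant function v on the indices weights each A by the
   positive part of min_A v - max_(complement of A) v; the sets of positive
   weight are the superlevel sets of v, so they form a chain, and the weights
   recover v up to a constant. Sphere to realization to sphere is the
   identity; the other composite is the map induced by t s, which is
   homotopic to the identity. *)
Require Import Defs.
From mathcomp Require Import all_boot all_order all_fingroup all_algebra lra.
Import Order.TTheory GRing.Theory Num.Theory.

Set Implicit Arguments.
Unset Strict Implicit.
Unset Printing Implicit Defensive.

Local Open Scope ring_scope.

(** * Gaps of a function on a finite set *)

Section LayerCake.
Context (R : realFieldType).

Lemma ler_sum_support (J : finType) (x : J -> R) (P Q : pred J) :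
  (forall j, 0 <= x j) -> (forall j, x j != 0 -> P j -> Q j) ->
  \sum_(j | P j) x j <= \sum_(j | Q j) x j.
Proof.
move=> x_ge0 PQ; rewrite big_mkcond [leRHS]big_mkcond; apply: ler_sum => j _.
have [->|xj0] := eqVneq (x j) 0; first by rewrite !if_same.
by case: (boolP (P j)) => [/(PQ j xj0) ->//|_]; case: ifP.
Qed.

Lemma eq_sum_support (J : finType) (x : J -> R) (P Q : pred J) :
  (forall j, x j != 0 -> P j = Q j) ->
  \sum_(j | P j) x j = \sum_(j | Q j) x j.
Proof.
move=> PQ; rewrite big_mkcond [RHS]big_mkcond; apply: eq_bigr => j _.
have [->|xj0] := eqVneq (x j) 0; first by rewrite !if_same.
by rewrite PQ.
Qed.

Context (I : finType).
Implicit Types (v : I -> R) (x : {set I} -> R) (A B : {set I}).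

(* The positive part of [min_A v - max_(~: A) v], for [A] nontrivial. The sum
   bounds every difference of [v], so as a default value it never interferes
   with the minimum. *)
Definition gap v A : R :=
  Num.max 0 (\big[Num.min/(\sum_(p : I * I) `|v p.1 - v p.2|)]_(p : I * I |
    (p.1 \in A) && (p.2 \notin A)) (v p.1 - v p.2)).

Lemma gap_ge0 v A : 0 <= gap v A.
Proof. by rewrite le_max lexx. Qed.

Lemma gap_eq v A i j : i \in A -> j \notin A -> v j <= v i ->
  (forall i' j', i' \in A -> j' \notin A -> v i - v j <= v i' - v j') ->
  gap v A = v i - v j.
Proof.
move=> iA jA vij min_ij; rewrite /gap max_r.
  apply/eqP; rewrite eq_le (bigmin_inf (i, j)) //= ?iA ?jA //.
  apply: le_bigmin => [|[i' j'] /andP[]]; last exact: min_ij.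
  rewrite (bigD1 (i, j)) //=; apply: ler_wpDr; last exact: ler_norm.
  by apply: sumr_ge0.
apply: le_bigmin; first by apply: sumr_ge0.
move=> [i' j'] /andP[iA' jA']; apply: le_trans (min_ij _ _ iA' jA').
by rewrite subr_ge0.
Qed.

Lemma gap_eq0 v A i j : i \in A -> j \notin A -> v i <= v j -> gap v A = 0.
Proof.
move=> iA jA vij; rewrite /gap max_l// (bigmin_inf (i, j)) //= ?iA ?jA //.
by rewrite subr_le0.
Qed.

(** For [i] in [A] but not [B] and [j] in [B] but not [A], one positive gap forces [v j < v i] and
    the other [v i < v j]. *)
Lemma gap_comparable v A B :
  gap v A != 0 -> gap v B != 0 -> (A \subset B) || (B \subset A).
Proof.
move=> gA gB; apply/negPn/negP; rewrite negb_or => /andP[].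
move=> /subsetPn[i iA iB] /subsetPn[j jB jA].
have [vij|/ltW vji] := leP (v i) (v j).
  by rewrite (gap_eq0 iA jA vij) eqxx in gA.
by rewrite (gap_eq0 jB iB vji) eqxx in gB.
Qed.

Definition chain_supported x := forall A B, x A != 0 -> x B != 0 ->
  (A \subset B) || (B \subset A).

(** The combination of indicator functions with coefficients [x]; on chain-supported [x], [gap]
    inverts it. *)
Definition level x i := \sum_(A : {set I} | i \in A) x A.

(** The support members strictly inside [A] have a largest one, so any point of [A] outside that one
    avoids them all. *)
Lemma chain_supported_outside x A : chain_supported x -> A != set0 ->
  exists2 i, i \in A & forall B, x B != 0 -> B \proper A -> i \notin B.
Proof.
move=> xc A0.
pose P B := (B == set0) || (x B != 0) && (B \proper A).
have P0 : P set0 by rewrite /P eqxx.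
have [M PM maxM] := arg_maxnP (fun B : {set I} => #|B|) P0.
have /properP[_ [i iA iM]] : M \proper A.
  by case/orP: PM => [/eqP->|/andP[]//]; rewrite proper0.
exists i => // B xB BA; apply: contra iM => iB.
have /orP[/eqP M0|/andP[xM _]] := PM.
  have := maxM B; rewrite /P xB BA orbT => /(_ isT).
  by rewrite M0 cards0 /= leqn0 cards_eq0 => /eqP B0; rewrite B0 inE in iB.
have /orP[/subsetP/(_ _ iB)//|MB] := xc _ _ xB xM.
suff -> : M = B by [].
by apply/eqP; rewrite eqEcard MB; apply: maxM; rewrite /P xB BA orbT.
Qed.

Lemma chain_supported_inside x A : chain_supported x -> A != setT ->
  exists2 j, j \notin A & forall B, x B != 0 -> A \proper B -> j \in B.
Proof.
move=> xc AT.
have [||j] := @chain_supported_outside (x \o (@setC I)) (~: A).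
- by move=> B C /= xB xC; rewrite -setCS orbC -setCS orbC; exact: xc.
- by rewrite -setCT (inj_eq (@setC_inj _)).
rewrite inE => jA jP; exists j => // B xB AB.
have := jP (~: B); rewrite /= setCK inE negbK; apply=> //.
by rewrite properC.
Qed.

(** If a support member crosses [A], then [x A = 0] and some point of [A] is no higher than some
    point outside, so the gap is 0. Otherwise the minimum over [A] counts exactly the members
    containing [A], the maximum outside counts those strictly containing it, and the difference is
    [x A]. *)
Lemma gap_level x v b A : (forall B, 0 <= x B) -> chain_supported x ->
  (forall i, v i = level x i + b) -> A != set0 -> A != setT -> gap v A = x A.
Proof.
move=> x_ge0 xc vE A0 AT.
have [/existsP[B /and3P[xB]]|] := boolP [exists B, [&& x B != 0,
    ~~ (A \subset B) & ~~ (B \subset A)]].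
  move=> /subsetPn[i iA iB] /subsetPn[j jB jA].
  have level_ij : v i <= v j.
    rewrite !vE lerD2r; apply: ler_sum_support => // C xC iC.
    have /orP[/subsetP/(_ _ iC)|/subsetP/(_ _ jB)//] := xc _ _ xC xB.
    by rewrite (negPf iB).
  rewrite (gap_eq0 iA jA level_ij).
  have [//|xA] := eqVneq (x A) 0.
  have /orP[/subsetP/(_ _ iA)|/subsetP/(_ _ jB)] := xc _ _ xA xB.
    by rewrite (negPf iB).
  by rewrite (negPf jA).
rewrite negb_exists => /forallP cmpA.
have {}cmpA B : x B != 0 -> (A \subset B) || (B \proper A).
  move=> xB; have := cmpA B; rewrite xB/= negb_and !negbK.
  by case: (boolP (A \subset B)) => //= nAB BA; rewrite properE BA.
have [i iA iP] := chain_supported_outside xc A0.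
have [j jA jP] := chain_supported_inside xc AT.
have lb k : k \in A -> \sum_(B : {set I} | A \subset B) x B <= level x k.
  by move=> kA; apply: ler_sum_support => // B _ /subsetP; exact.
have ub k : k \notin A -> level x k <= \sum_(B : {set I} | A \proper B) x B.
  move=> kA; apply: ler_sum_support => // B xB kB.
  have /orP[AB|/proper_sub/subsetP/(_ _ kB)] := cmpA B xB.
    by rewrite properE AB; apply: contra kA => /subsetP; exact.
  by rewrite (negPf kA).
have Ei : level x i = \sum_(B : {set I} | A \subset B) x B.
  apply: le_anti; rewrite lb// andbT; apply: ler_sum_support => // B xB iB.
  by have /orP[//|/(iP _ xB)] := cmpA B xB; rewrite iB.
have Ej : level x j = \sum_(B : {set I} | A \proper B) x B.
  apply: le_anti; rewrite ub//=; exact: ler_sum_support.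
have Exy : \sum_(B : {set I} | A \subset B) x B
    = x A + \sum_(B : {set I} | A \proper B) x B.
  rewrite (bigD1 A)//=; congr (_ + _); apply: eq_bigl => B.
  by rewrite properEneq eq_sym andbC.
have -> : x A = v i - v j by rewrite !vE Ei Ej Exy; lra.
apply: gap_eq => //; first by rewrite !vE Ei Ej Exy lerD2r lerDr.
move=> i' j' iA' jA'; rewrite !vE Ei Ej.
have := lb _ iA'; have := ub _ jA'; lra.
Qed.

(* Induction on the support [A] of [v], splitting off [min_A v] times the
   indicator of [A]. *)
Lemma chain_decomposition v : (forall i, 0 <= v i) ->
  exists x, [/\ forall A, 0 <= x A, chain_supported x,
    forall A, x A != 0 -> A != set0 /\ A \subset [set i | v i != 0]
    & forall i, v i = level x i].
Proof.
have [m] := ubnP #|[set i | v i != 0]|; elim: m v => // m IHm v vm v_ge0.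
set A := [set i | v i != 0] in vm *.
have inA i : (i \in A) = (v i != 0) by rewrite /A inE.
have [A0|[k kA]] := set_0Vmem A.
  exists (fun=> 0); split=> //; first by move=> B C; rewrite eqxx.
    by move=> B; rewrite eqxx.
  move=> i; rewrite /level big1//; apply/eqP/negPn/negP => vi.
  by rewrite -inA A0 inE in vi.
have [i iA' imin] := arg_minP v kA; have iA : i \in A := iA'.
have vi_gt0 : 0 < v i by rewrite lt_def v_ge0 andbT -inA.
pose w j := if j \in A then v j - v i else 0.
have w_ge0 j : 0 <= w j by rewrite /w; case: ifP => // /imin; rewrite subr_ge0.
have wA : [set j | w j != 0] \proper A.
  apply/properP; split; last by exists i; rewrite // inE /w iA subrr eqxx.
  by apply/subsetP => j; rewrite inE /w; case: ifP => //; rewrite eqxx.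
have [|x [x_ge0 xc xA wE]] := IHm w _ w_ge0.
  by apply: leq_trans (proper_card wA) _.
(* [w] vanishes at the minimizer [i], so the decomposition of [w] leaves [A] free to receive the
   weight [v i]. *)
have xA0 : x A = 0.
  apply/eqP/negPn/negP => /xA[_] AA.
  by have := sub_proper_trans AA wA; rewrite properxx.
exists (fun B => if B == A then v i else x B); split.
- by move=> B; case: ifP => // _; exact: ltW.
- move=> B C; have [->|_] := eqVneq B A; have [->|_] := eqVneq C A;
  rewrite ?subxx//.
  + by move=> _ /xA[_ /subset_trans/(_ (proper_sub wA)) ->]; rewrite orbT.
  + by move=> /xA[_ /subset_trans/(_ (proper_sub wA)) ->].
  + exact: xc.
- move=> B; have [-> _|_ /xA[-> BA]] := eqVneq B A.
    by split=> //; apply/set0Pn; exists k.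
  by split=> //; exact: subset_trans BA (proper_sub wA).
move=> j; rewrite /level; have [jA|jA] := boolP (j \in A); last first.
  have := wE j; rewrite /level {1}/w (negPf jA) => wj.
  rewrite (eq_bigr x) => [|B jB]; last first.
    by case: eqP => // BA; rewrite BA (negPf jA) in jB.
  by rewrite -wj; apply/eqP; rewrite inA negbK in jA.
rewrite (bigD1 A)//= eqxx (eq_bigr x) => [|B /andP[_ /negPf ->]//].
have := wE j; rewrite /level {1}/w jA (bigD1 A)//= xA0 add0r => <-.
by rewrite addrC subrK.
Qed.

Definition nontrivial A := (A != set0) && (A != setT).

(* The sets of positive gap are the superlevel sets of [v]: the function [v] is,
   up to a constant, the sum of their indicators weighted by the gaps. *)
Lemma layer_cake v i j :
  v i - v j = \sum_(A : {set I} | nontrivial A && (i \in A)) gap v A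
            - \sum_(A : {set I} | nontrivial A && (j \in A)) gap v A.
Proof.
have [k _ kmin] := arg_minP v (isT : xpredT i).
have [|x [x_ge0 xc xP vE]] := @chain_decomposition (fun l => v l - v k).
  by move=> l; rewrite subr_ge0 kmin.
have vE' l : v l = level x l + v k by rewrite -vE subrK.
have sum_gap l : \sum_(A : {set I} | nontrivial A && (l \in A)) gap v A
    = level x l.
  rewrite (eq_bigr x); last first.
    by move=> A /andP[/andP[A0 AT] _]; exact: gap_level vE' A0 AT.
  apply: eq_sum_support => A /xP[A0 /subsetP Asub].
  rewrite /nontrivial A0/= -[RHS]andTb; congr (_ && _).
  (* The full set contains the minimizer [k], where the shifted function vanishes, so it carries no
     weight. *)
  apply: contraTneq isT => AT; have := Asub k; rewrite AT !inE => /(_ isT).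
  by rewrite subrr eqxx.
by rewrite !sum_gap (vE' i) (vE' j); lra.
Qed.

End LayerCake.

From mathcomp Require Import all_classical all_reals all_analysis.
Import numFieldNormedType.Exports.
Import Order.DefaultSetSubsetOrder.

Local Open Scope classical_set_scope.

(** * Continuity *)

Section Continuity.
Context (R : realType).

Lemma realization_coord_continuous (V : finType) (K : {set {set V}}) (v : V) :
  continuous (fun x : realization R K => (set_val x v : R)).
Proof.
move=> x; apply: (@continuous_comp _ _ _
  (set_val : realization R K -> {ptws V -> (R : topologicalType)}) (proj v)).
  exact: initial_continuous.
exact: (@proj_continuous V (fun=> (R : topologicalType)) v).
Qed.

Lemma continuous_realization (Z : topologicalType) (V : finType)
    (K : {set {set V}}) (f : Z -> realization R K) :
  (forall v, continuous (fun z => set_val (f z) v : R)) -> continuous f.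
Proof.
move=> fc; apply: continuous_comp_initial => z.
apply/cvg_sup => v U [_ [[W oW <-]] /= Wfz sU].
have : nbhs z ((fun z => set_val (f z) v : R) @^-1` W).
  by apply: (fc v z); exact: open_nbhs_nbhs.
by apply: filterS => y Wy; apply: sU.
Qed.

Lemma sphere_coord_continuous n (i : 'I_n) :
  continuous (fun x : unit_sphere R n => (set_val x ord0 i : R)).
Proof.
move=> x; apply: (@continuous_comp _ _ _
  (set_val : unit_sphere R n -> 'rV[R]_n) (fun y => y ord0 i)).
  exact: initial_continuous.
exact: coord_continuous.
Qed.

Lemma continuous_sphere (Z : topologicalType) n (f : Z -> unit_sphere R n) :
  (forall i, continuous (fun z => set_val (f z) ord0 i : R)) -> continuous f.
Proof.
move=> fc; apply: continuous_comp_initial => z.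
move=> U [P nP sU].
have : \forall y \near z, forall i, P ord0 i (set_val (f y) ord0 i).
  by apply: filter_forall => i; apply: (fc i z); exact: nP.
by apply: filterS => y Wy; apply: sU => i j; rewrite ord1; apply: Wy.
Qed.

Context (Z : topologicalType).
Implicit Types f g : Z -> R.

Lemma continuous_sum (I : finType) (P : pred I) (F : I -> Z -> R) :
  (forall i, P i -> continuous (F i)) ->
  continuous (fun z => \sum_(i | P i) F i z).
Proof. exact: (@continuous_big R I +%R 0 P (@add_continuous R) Z _ F).
Qed.

Lemma continuous_bigmin (I : finType) (P : pred I) (F : I -> Z -> R) f :
  continuous f -> (forall i, P i -> continuous (F i)) ->
  continuous (fun z => \big[Num.min/f z]_(i | P i) F i z).
Proof.
move=> fc Fc; rewrite /index_enum; elim: (Finite.enum _) => [|i s IHs].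
  by under eq_fun do rewrite big_nil.
under eq_fun do rewrite big_cons; case: (boolP (P i)) => // Pi z.
by apply: continuous_min; [exact: Fc|exact: IHs].
Qed.

Lemma continuous_max0 f : continuous f -> continuous (fun z => Num.max 0 (f z)).
Proof.
move=> fc z; apply: (@continuous_max R Z (fun=> 0) f) => //; last exact: fc.
exact: cvg_cst.
Qed.

Lemma continuous_minr f g : continuous f -> continuous g ->
  continuous (fun z => Num.min (f z) (g z)).
Proof.
move=> fc gc z.
by apply: (@continuous_min R Z f g); [exact: fc|exact: gc].
Qed.

Lemma continuous_addr f g : continuous f -> continuous g ->
  continuous (fun z => f z + g z).
Proof. by move=> fc gc z; apply: continuousD; [exact: fc|exact: gc]. Qed.

Lemma continuous_subr f g : continuous f -> continuous g ->
  continuous (fun z => f z - g z).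
Proof. by move=> fc gc z; apply: continuousB; [exact: fc|exact: gc]. Qed.

Lemma continuous_sqr f : continuous f -> continuous (fun z => f z ^+ 2).
Proof. by move=> fc z; apply: cvgM; exact: fc. Qed.

Lemma continuous_norm f : continuous f -> continuous (fun z => `|f z|).
Proof. by move=> fc z; apply: cvg_norm; exact: fc. Qed.

Lemma continuous_sqrt f : continuous f ->
  continuous (fun z => Num.sqrt (f z)).
Proof.
move=> fc z; apply: (@continuous_comp _ _ _ f (@Num.sqrt R)); first exact: fc.
exact: sqrt_continuous.
Qed.

Lemma continuous_div f g :
  continuous f -> continuous g -> (forall z, g z != 0) ->
  continuous (fun z => f z / g z).
Proof.
move=> fc gc g0 z; apply: cvgM; first exact: fc.
by apply: cvgV => //; exact: gc.
Qed.

End Continuity.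

(** * Closure operators on order complexes *)

Section ChainWeights.
Context (R : realType) (d : Order.disp_t) (V : finPOrderType d) (P : {set V}).

(** Membership in the realization, unfolded to conditions on a plain function so that points can be
    built coordinatewise. *)
Definition chain_weights (x : V -> R) : Prop :=
  [/\ forall v, 0 <= x v, \sum_v x v = 1, forall v, x v != 0 -> v \in P
    & forall u v, x u != 0 -> x v != 0 -> (u >=< v)%O].

Lemma chain_weightsP (x : V -> R) :
  [/\ forall v, 0 <= x v, \sum_v x v = 1
    & [set v | x v != 0]%SET \in order_complex P] <-> chain_weights x.
Proof.
split=> [[x0 x1]|[x0 x1 xP xc]].
  rewrite inE => /andP[/fintype.subsetP xP /fintype.forall_inP xc].
  split=> // [v xv|u v xu xv].
    by apply: xP; rewrite inE.
  have := xc u; rewrite inE xu => /(_ isT)/fintype.forall_inP.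
  by move=> /(_ v); rewrite inE; exact.
split=> //; rewrite inE; apply/andP; split.
  by apply/fintype.subsetP => v; rewrite inE; exact: xP.
apply/fintype.forall_inP => u; rewrite inE => xu.
by apply/fintype.forall_inP => v; rewrite inE; exact: xc.
Qed.

Lemma realizationP (x : realization R (order_complex P)) :
  chain_weights (set_val x : V -> R).
Proof. by apply/chain_weightsP; exact: (set_valP x). Qed.

Definition realize (x : V -> R) (xw : chain_weights x) :
    realization R (order_complex P) :=
  exist _ (x : {ptws V -> (R : topologicalType)})
    (mem_set (proj2 (chain_weightsP x) xw)).

Lemma realizeE (x : V -> R) (xw : chain_weights x) v :
  set_val (realize xw) v = x v.
Proof. by []. Qed.

Lemma realization_inj (x y : realization R (order_complex P)) :
  (forall v, set_val x v = set_val y v :> R) -> x = y.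
Proof. by move=> xy; apply: val_inj; apply/funext. Qed.

End ChainWeights.

Section ClosureHomotopy.
Context (R : realType) (d : Order.disp_t) (V : finPOrderType d) (P : {set V}).
Context (phi : V -> V).
Hypothesis phiP : forall p, p \in P -> phi p \in P.
Hypothesis phi_mono : forall p q, p \in P -> q \in P ->
  (p <= q)%O -> (phi p <= phi q)%O.
Hypothesis phi_ge : forall p, p \in P -> (p <= phi p)%O.

Let X := realization R (order_complex P).
Implicit Types (x : V -> R) (t : R).

(* Stacking the masses [x q] along the chain, greatest element on top, the
   homotopy at time [t] has transported the top layer of thickness [t] along
   [phi]: elements that still carry mass lie below those that lost some, so the
   support remains a chain. *)
Definition mass_above x (q : V) := \sum_(p | (q < p)%O) x p.

Definition moved_mass t x q := Num.max 0 (Num.min (x q) (t - mass_above x q)).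

Definition slide t x p :=
  x p - moved_mass t x p + \sum_(q | phi q == p) moved_mass t x q.

Lemma moved_ge0 t x q : 0 <= moved_mass t x q.
Proof. by rewrite le_max lexx. Qed.

Lemma moved_le t x q : 0 <= x q -> moved_mass t x q <= x q.
Proof. by move=> xq; rewrite ge_max xq ge_min lexx. Qed.

(** Measured from the top of the stack, the layer of [q] runs from depth [mass_above x q] to
    [mass_above x q + x q]. It loses mass only if it starts before depth [t], and by [moved_neq]
    keeps some only if it ends after. *)
Lemma moved_neq0 t x q : 0 <= x q -> moved_mass t x q != 0 ->
  x q != 0 /\ mass_above x q < t.
Proof.
move=> xq mq; have : 0 < moved_mass t x q by rewrite lt_def mq moved_ge0.
by rewrite lt_max ltxx lt_min => /andP[/gt_eqF -> ]; rewrite subr_gt0.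
Qed.

Lemma moved_neq t x q : 0 <= x q -> x q - moved_mass t x q != 0 ->
  x q != 0 /\ t < mass_above x q + x q.
Proof.
move=> xq mq; have : moved_mass t x q < x q.
  by rewrite lt_def -subr_eq0 mq moved_le.
rewrite gt_max gt_min ltxx /= => /andP[/gt_eqF -> ]; split=> //; lra.
Qed.

Lemma slide_weights t x : chain_weights P x -> chain_weights P (slide t x).
Proof.
move=> [x_ge0 x1 xP xc].
have slide_neq0 p : slide t x p != 0 ->
    (x p != 0 /\ t < mass_above x p + x p) \/
    exists q, [/\ phi q = p, x q != 0 & mass_above x q < t].
  rewrite /slide; have [->|mp _] := eqVneq (x p - moved_mass t x p) 0.
    rewrite add0r => /eqP s0; right; apply: contrapT => nq; apply: s0.
    rewrite big1// => q /eqP phiq; apply/eqP/negPn/negP => mq; apply: nq.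
    by exists q; have [] := moved_neq0 (x_ge0 q) mq.
  by left; exact: moved_neq.
(* If [q < p], the whole layer of [p] lies above that of [q], so it could not end after depth [t]
   while that of [q] starts before. *)
have stay_below p q : x p != 0 -> t < mass_above x p + x p ->
    x q != 0 -> mass_above x q < t -> (p <= q)%O.
  move=> xp tp xq tq; have /comparable_leP := xc _ _ xp xq; case=> // qp.
  suff : mass_above x p + x p <= mass_above x q by lra.
  rewrite /mass_above [leRHS](bigD1 p)//= [leRHS]addrC lerD2r.
  apply: ler_sum_support => // r xr pr.
  by rewrite (lt_trans qp pr) gt_eqF.
have mixed p q : x p != 0 -> t < mass_above x p + x p ->
    x q != 0 -> mass_above x q < t -> (p <= phi q)%O.
  by move=> xp tp xq tq; apply: le_trans (phi_ge (xP _ xq)); exact: stay_below.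
split.
- move=> p; rewrite /slide addr_ge0 ?subr_ge0 ?moved_le//.
  by apply: sumr_ge0 => q _; exact: moved_ge0.
- rewrite /slide big_split /= sumrB x1.
  (* Grouping the moved mass by its target shows that all of it arrives. *)
  rewrite [X in _ + X](_ : _ = \sum_v moved_mass t x v) ?subrK//.
  by rewrite [RHS](partition_big phi xpredT).
- by move=> p /slide_neq0[[/xP]|[q [<- /xP/phiP]]].
move=> u v /slide_neq0[[xu tu]|[p [<- xp tp]]];
  move=> /slide_neq0[[xv tv]|[q [<- xq tq]]].
- exact: xc.
- by rewrite /Order.comparable mixed.
- by rewrite /Order.comparable mixed// orbT.
rewrite /Order.comparable; have /orP[pq|qp] := xc _ _ xp xq.
  by rewrite phi_mono ?xP.
by rewrite orbC phi_mono ?xP.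
Qed.

Lemma slide0 x p : chain_weights P x -> slide 0 x p = x p.
Proof.
move=> [x_ge0 _ _ _]; have m0 q : moved_mass 0 x q = 0.
  apply/eqP/negPn/negP => /(moved_neq0 (x_ge0 q))[_].
  by apply/negP; rewrite -leNgt; apply: sumr_ge0.
by rewrite /slide m0 subr0 big1 ?addr0.
Qed.

(** The total mass is 1, so every layer ends by depth 1 and has moved entirely; the result is the
    map induced by [phi]. *)
Lemma slide1 x p : chain_weights P x ->
  slide 1 x p = \sum_(q | phi q == p) x q.
Proof.
move=> [x_ge0 x1 _ _]; have m1 q : moved_mass 1 x q = x q.
  apply/eqP; rewrite eq_sym -subr_eq0; apply/negPn/negP.
  move=> /(moved_neq (x_ge0 q))[_]; apply/negP; rewrite -leNgt -x1.
  rewrite [leRHS](bigD1 q)//= [leRHS]addrC lerD2r.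
  by apply: ler_sum_support => // r xr qr; rewrite gt_eqF.
by rewrite /slide m1 subrr add0r; apply: eq_bigr.
Qed.

Lemma closure_homotopic_id (h : X -> X) :
  (forall (x : X) p,
    set_val (h x) p = \sum_(q | phi q == p) set_val x q :> R) ->
  homotopic R h idfun.
Proof.
move=> hE.
(* Time is reversed: [slide] starts at the identity, whereas the homotopy starts at [h]. *)
pose H (tx : R * X) : X :=
  realize (slide_weights (1 - tx.1) (realizationP tx.2)).
exists H; split.
- apply: continuous_subspaceT; apply: continuous_realization => v.
  have cx p : continuous (fun tx : R * X => (set_val tx.2 p : R)).
    move=> tx; apply: (@continuous_comp _ _ _ (@snd R X)
      (fun x : X => (set_val x p : R))).
      exact: cvg_snd.
    exact: realization_coord_continuous.
  have ct : continuous (fun tx : R * X => 1 - tx.1).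
    by move=> tx; apply: continuousB; [exact: cvg_cst|exact: cvg_fst].
  have cm p : continuous (fun tx : R * X =>
      moved_mass (1 - tx.1) (set_val tx.2) p).
    apply: continuous_max0; apply: continuous_minr; first exact: cx.
    by apply: continuous_subr; [exact: ct|apply: continuous_sum].
  apply: continuous_addr; last by apply: continuous_sum => q _; exact: cm.
  by apply: continuous_subr; [exact: cx|exact: cm].
- move=> x; apply: realization_inj => v.
  by rewrite hE realizeE /= subr0 slide1//; exact: realizationP.
- move=> x; apply: realization_inj => v.
  by rewrite realizeE /= subrr slide0//; exact: realizationP.
Qed.

End ClosureHomotopy.

(** * Comparison with the sphere *)

Section LevelMap.
Context (R : realType) (d : Order.disp_t) (V : finPOrderType d) (P : {set V}).
Context (n : nat) (sigma : V -> {set 'I_n.+1}) (tau : {set 'I_n.+1} -> V).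
Hypothesis sigma_mono : forall p q, p \in P -> q \in P ->
  (p <= q)%O -> sigma p \subset sigma q.
Hypothesis tau_mono : forall A B : {set 'I_n.+1}, A \subset B ->
  (tau A <= tau B)%O.
Hypothesis sigmaP : forall p, p \in P -> nontrivial (sigma p).
Hypothesis tauP : forall A, nontrivial A -> tau A \in P.
Hypothesis tauK : forall A, nontrivial A -> sigma (tau A) = A.
Hypothesis tau_sigma_ge : forall p, p \in P -> (p <= tau (sigma p))%O.

Local Notation X := (realization R (order_complex P)).
Local Notation S := (unit_sphere R n).
Implicit Types (x : V -> R) (v : 'I_n.+1 -> R) (A : {set 'I_n.+1}).

Definition push x A := \sum_(p | sigma p == A) x p.

Lemma sum_push x (Q : pred {set 'I_n.+1}) :
  \sum_(A | Q A) push x A = \sum_(p | Q (sigma p)) x p.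
Proof.
rewrite [RHS](partition_big sigma Q)//=; apply: eq_bigr => A QA.
by apply: eq_bigl => p; case: eqP => [->|]; rewrite ?QA ?andbF.
Qed.

Lemma push_neq0 x A : push x A != 0 -> exists2 p, sigma p = A & x p != 0.
Proof.
move=> xA; apply: contrapT => np; move/eqP: xA; apply.
rewrite /push big1// => p /eqP pA; apply/eqP/negPn/negP => xp; apply: np.
by exists p.
Qed.

Lemma push_ge0 x A : chain_weights P x -> 0 <= push x A.
Proof. by move=> [x_ge0 _ _ _]; apply: sumr_ge0. Qed.

Lemma push_chain_supported x : chain_weights P x -> chain_supported (push x).
Proof.
move=> [_ _ xP xc] _ _ /push_neq0[p <- xp] /push_neq0[q <- xq].
have /orP[pq|qp] := xc _ _ xp xq.
  by rewrite sigma_mono ?xP.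
by rewrite orbC sigma_mono ?xP.
Qed.

Definition height x i := \sum_(p | i \in sigma p) x p.

Lemma height_level x i : height x i = level (push x) i.
Proof. by rewrite /level (sum_push x (fun A : {set _} => i \in A)). Qed.

Definition height_norm x :=
  Num.sqrt (\sum_(j < n) (height x (lift ord0 j) - height x ord0) ^+ 2).

Lemma sum_sqr_gt0 (w : 'I_n -> R) j : w j != 0 -> 0 < \sum_i w i ^+ 2.
Proof.
move=> wj; rewrite (bigD1 j)//= ltr_wpDr//.
  by apply: sumr_ge0 => i _; exact: sqr_ge0.
by rewrite lt_def sqrf_eq0 wj sqr_ge0.
Qed.

(** Take [p] carrying mass. Constant heights would make the gap at the nontrivial set [sigma p]
    zero, but by [gap_level] this gap is [push x (sigma p)], which is at least [x p]. *)
Lemma height_norm_gt0 x : chain_weights P x -> 0 < height_norm x.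
Proof.
move=> xw; rewrite sqrtr_gt0.
have [p xp] : exists p, x p != 0.
  apply: contrapT => x0; have [_ + _ _] := xw; rewrite big1 => [/esym/eqP|p _].
    by rewrite oner_eq0.
  by apply/eqP/negPn/negP => xp; apply: x0; exists p.
have [x_ge0 _ xP _] := xw.
have /andP[A0 AT] := sigmaP (xP _ xp).
have [w0|] := boolP [forall j, height x (lift ord0 j) - height x ord0 == 0];
  last by rewrite negb_forall => /existsP[j]; exact: sum_sqr_gt0.
have heightE i : height x i = height x ord0.
  case: (unliftP ord0 i) => [j ->|->//].
  by apply/eqP; rewrite -subr_eq0; exact: (forallP w0).
have gapE : gap (height x) (sigma p) = push x (sigma p).
  apply: (gap_level (b := 0)) => //; first by move=> B; exact: push_ge0.
    exact: push_chain_supported.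
  by move=> i; rewrite addr0 height_level.
have [i iA] := set0Pn _ A0.
have [j jA] : exists j, j \notin sigma p.
  move: AT; rewrite -finset.subTset => /subsetPn[j _ jA].
  by exists j.
move: gapE; rewrite (gap_eq0 iA jA) ?heightE// => /esym/eqP.
rewrite /push psumr_eq0// => /allP/(_ p); rewrite mem_index_enum eqxx/=.
by rewrite (negPf xp) => /(_ isT).
Qed.

Lemma height_normalized x : chain_weights P x ->
  \sum_(j < n) ((\row_(i < n) ((height x (lift ord0 i) - height x ord0)
    / height_norm x)) ord0 j) ^+ 2 = 1 :> R.
Proof.
move=> xw; under eq_bigr do rewrite mxE expr_div_n.
rewrite -mulr_suml sqr_sqrtr ?divff//.
  by have := height_norm_gt0 xw; rewrite sqrtr_gt0 => /gt_eqF ->.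
by apply: sumr_ge0 => i _; exact: sqr_ge0.
Qed.

Definition to_sphere (x : X) : S :=
  exist _ (\row_(i < n) ((height (set_val x) (lift ord0 i)
      - height (set_val x) ord0) / height_norm (set_val x)))
    (mem_set (height_normalized (realizationP x))).

Lemma to_sphereE (x : X) j : set_val (to_sphere x) ord0 j =
  (height (set_val x) (lift ord0 j) - height (set_val x) ord0)
    / height_norm (set_val x).
Proof. by rewrite [LHS]mxE. Qed.

(** Of the functions with prescribed differences to their value at index 0, the one vanishing
    there. *)
Definition extend0 (y : 'rV[R]_n) (i : 'I_n.+1) : R :=
  if unlift ord0 i is Some j then y ord0 j else 0.

(** Several [p] may share a trace; the test [tau (sigma p) == p] puts the whole weight of a set [A]
    on the single element [tau A]. *)
Definition gap_weight v p : R :=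
  if nontrivial (sigma p) && (tau (sigma p) == p) then gap v (sigma p) else 0.

Definition total_gap v := \sum_(A | nontrivial A) gap v A.

Lemma sum_gap_weight v (Q : pred {set 'I_n.+1}) :
  \sum_(p | Q (sigma p)) gap_weight v p
    = \sum_(A | nontrivial A && Q A) gap v A.
Proof.
rewrite (reindex_onto sigma tau) => [|A /andP[/tauK]//].
rewrite /gap_weight -big_mkcondr; apply: eq_bigl => p.
by rewrite andbCA andbA.
Qed.

Lemma gap_weight_ge0 v p : 0 <= gap_weight v p.
Proof. by rewrite /gap_weight; case: ifP => // _; exact: gap_ge0. Qed.

Lemma gap_weight_neq0 v p : gap_weight v p != 0 ->
  [/\ p \in P, tau (sigma p) = p & gap v (sigma p) != 0].
Proof.
rewrite /gap_weight; case: ifPn => [/andP[nA /eqP pE] gA|];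
  last by rewrite eqxx.
by split=> //; rewrite -pE; exact: tauP.
Qed.

(** By [layer_cake], a function whose gaps all vanish is constant. *)
Lemma total_gap_gt0 v i j : v i != v j -> 0 < total_gap v.
Proof.
rewrite lt_def sumr_ge0 ?andbT => [|A _]; last exact: gap_ge0.
apply: contraNN; rewrite psumr_eq0 => [/allP v0|A _]; last exact: gap_ge0.
rewrite -subr_eq0 (layer_cake v i j) !big1 ?subrr// => A /andP[nA _];
  by have := v0 A; rewrite mem_index_enum nA => /(_ isT)/eqP.
Qed.

Lemma total_gap_extend0_gt0 (y : S) : 0 < total_gap (extend0 (set_val y)).
Proof.
have [j yj] : exists j, set_val y ord0 j != 0.
  apply: contrapT => y0; have := set_valP y; rewrite /= big1.
    by move=> /esym/eqP; rewrite oner_eq0.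
  move=> i _; apply/eqP; rewrite sqrf_eq0; apply/negPn/negP => yi.
  by apply: y0; exists i.
apply: (@total_gap_gt0 _ (lift ord0 j) ord0).
by rewrite /extend0 liftK unlift_none.
Qed.

Lemma gap_weight_chain v : 0 < total_gap v ->
  chain_weights P (fun p => gap_weight v p / total_gap v).
Proof.
move=> tv; split.
- by move=> p; rewrite divr_ge0 ?gap_weight_ge0// ltW.
- rewrite -mulr_suml (sum_gap_weight v xpredT) (eq_bigl (@nontrivial _)).
    by rewrite divff// gt_eqF.
  by move=> A; rewrite andbT.
- by move=> p; rewrite mulf_eq0 negb_or => /andP[/gap_weight_neq0[]].
move=> p q; rewrite !mulf_eq0 !negb_or.
move=> /andP[/gap_weight_neq0[_ pE gp] _] /andP[/gap_weight_neq0[_ qE gq] _].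
rewrite -pE -qE; have /orP[pq|qp] := gap_comparable gp gq.
  by rewrite /Order.comparable tau_mono.
by rewrite /Order.comparable orbC tau_mono.
Qed.

Definition from_sphere (y : S) : X :=
  realize (gap_weight_chain (total_gap_extend0_gt0 y)).

Lemma to_sphere_continuous : continuous to_sphere.
Proof.
have cx p : continuous (fun x : X => (set_val x p : R)).
  exact: realization_coord_continuous.
have ch i : continuous (fun x : X => height (set_val x) i).
  by apply: continuous_sum.
apply: continuous_sphere => j.
rewrite (_ : (fun _ => _) = fun x : X => (height (set_val x) (lift ord0 j)
  - height (set_val x) ord0) / height_norm (set_val x)); last first.
  by apply/funext => x; rewrite to_sphereE.
apply: continuous_div.
- by apply: continuous_subr.
- apply: continuous_sqrt; apply: continuous_sum => i _.
  by apply: continuous_sqr; apply: continuous_subr.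
- by move=> x; rewrite gt_eqF// height_norm_gt0//; exact: realizationP.
Qed.

Lemma from_sphere_continuous : continuous from_sphere.
Proof.
have ce i : continuous (fun y : S => extend0 (set_val y) i).
  rewrite /extend0; case: (unlift ord0 i) => [j|]; last exact: cst_continuous.
  exact: sphere_coord_continuous.
have cg A : continuous (fun y : S => gap (extend0 (set_val y)) A).
  apply: continuous_max0; apply: continuous_bigmin => [|ij _].
    by apply: continuous_sum => ij _; apply: continuous_norm;
      apply: continuous_subr; exact: ce.
  by apply: continuous_subr; exact: ce.
have cw p : continuous (fun y : S => gap_weight (extend0 (set_val y)) p).
  rewrite /gap_weight; case: (_ && _); first exact: cg.
  exact: cst_continuous.
apply: continuous_realization => p; apply: continuous_div => [|| y].
- exact: cw.
- by apply: continuous_sum => A _; exact: cg.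
- by rewrite gt_eqF// total_gap_extend0_gt0.
Qed.

(** By [layer_cake], the height differences of [from_sphere y] are the coordinates of [y] divided by
    the total gap; as [y] has norm 1, normalizing removes this factor. *)
Lemma from_sphereK : cancel from_sphere to_sphere.
Proof.
move=> y; set v := extend0 (set_val y).
have tv : 0 < total_gap v := total_gap_extend0_gt0 y.
have hE j : height (set_val (from_sphere y)) (lift ord0 j)
    - height (set_val (from_sphere y)) ord0 = set_val y ord0 j / total_gap v.
  have hE i : height (set_val (from_sphere y)) i =
      (\sum_(A | nontrivial A && (i \in A)) gap v A) / total_gap v.
    by rewrite -(sum_gap_weight v (fun A : {set _} => i \in A)) mulr_suml.
  rewrite !hE -mulrBl -layer_cake /v /extend0 liftK unlift_none subr0//.
have nE : height_norm (set_val (from_sphere y)) = (total_gap v)^-1.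
  rewrite /height_norm; under eq_bigr do rewrite hE expr_div_n.
  rewrite -mulr_suml (set_valP y : \sum_i _ = 1) mul1r -exprVn sqrtr_sqr.
  by rewrite ger0_norm// invr_ge0 ltW.
apply: val_inj; apply/rowP => j; rewrite [LHS]to_sphereE hE nE invrK.
by rewrite divfK// gt_eqF.
Qed.

(** Up to a constant, the extended sphere point is the level function of [push w] divided by the
    norm, so [gap_level] recovers these weights. Their total is the inverse of the norm, because
    [push w] has mass 1 on nontrivial sets, and dividing by it leaves [push w]. *)
Lemma to_sphereK (x : X) p : set_val (from_sphere (to_sphere x)) p
  = \sum_(q | tau (sigma q) == p) set_val x q :> R.
Proof.
have xw := realizationP x; set w := (set_val x : V -> R) in xw *.
have Nw := height_norm_gt0 xw; have [x_ge0 x1 xP xc] := xw.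
set v := extend0 (set_val (to_sphere x)).
have gapE A : nontrivial A -> gap v A = push w A / height_norm w.
  move=> /andP[A0 AT].
  apply: (gap_level (x := fun B => push w B / height_norm w)
    (b := - height w ord0 / height_norm w)) => //.
  - by move=> B; rewrite divr_ge0 ?push_ge0// ltW.
  - move=> B C; rewrite !mulf_eq0 !negb_or => /andP[wB _] /andP[wC _].
    exact: (push_chain_supported xw).
  move=> i; have -> : level (fun B => push w B / height_norm w) i
      = height w i / height_norm w by rewrite height_level /level mulr_suml.
  rewrite -mulrDl /v /extend0; case: (unliftP ord0 i) => [j ->|->].
    by rewrite to_sphereE.
  by rewrite subrr mul0r.
have total_gapE : total_gap v = (height_norm w)^-1.
  rewrite /total_gap (eq_bigr _ gapE) -mulr_suml (sum_push w (@nontrivial _)).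
  rewrite (eq_sum_support (Q := xpredT)) ?x1 ?mul1r// => q /xP/sigmaP ->//.
rewrite [LHS]realizeE -/v total_gapE invrK /gap_weight.
case: ifPn => [/andP[nA /eqP pE]|np].
  rewrite gapE// divfK ?gt_eqF// /push; apply: eq_sum_support => q /xP qP.
  apply/eqP/eqP => [->//|<-]; rewrite tauK//; exact: sigmaP.
(* Mass at a [q] sent to [p] would make [p] a fixed point of [tau \o sigma] with nontrivial trace,
   which is excluded here. *)
rewrite mul0r big1// => q /eqP qp; apply/eqP/negPn/negP => /xP/sigmaP nq.
by move/negP: np; apply; rewrite -qp tauK// nq eqxx.
Qed.

Lemma order_complex_sphere : homotopy_equivalent R X S.
Proof.
exists to_sphere, from_sphere; split.
- exact: to_sphere_continuous.
- exact: from_sphere_continuous.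
- apply: (closure_homotopic_id (phi := tau \o sigma)).
  + by move=> p pP; apply: tauP; exact: sigmaP.
  + by move=> p q pP qP pq; apply: tau_mono; exact: sigma_mono.
  + exact: tau_sigma_ge.
  + exact: to_sphereK.
(* This composite equals the identity, so the constant homotopy suffices. *)
exists snd; split=> [|y|y] //=; last by rewrite from_sphereK.
apply: continuous_subspaceT => ty; exact: cvg_snd.
Qed.

End LevelMap.

(** * Subracks and orbits *)

Lemma homotopy_equivalent_empty (R : realType) (X Y : topologicalType) :
  (X -> False) -> (Y -> False) -> homotopy_equivalent R X Y.
Proof.
move=> X0 Y0; exists (fun x => False_rect Y (X0 x)).
exists (fun y => False_rect X (Y0 y)).
split=> [x|y||]; [by case: (X0 x)|by case: (Y0 y)| |].
- exists snd; split=> [|x|x]; try by case: (X0 x).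
  by apply: continuous_subspaceT => tx; exact: cvg_snd.
exists snd; split=> [|y|y]; try by case: (Y0 y).
by apply: continuous_subspaceT => ty; exact: cvg_snd.
Qed.

Section RackOrbits.
Context (T : finType) (op : T -> T -> T).
Hypothesis opR : is_rack op.

Lemma op_inj a : injective (op a).
Proof.
have [_ _ opU] := opR; move=> b c bc.
have [x [_ xU]] := opU a (op a b) (finset.in_setT _) (finset.in_setT _).
by rewrite -(xU b) ?(xU c)//; split; rewrite ?inE.
Qed.

Lemma op_orbit a b : orbit 'P (Inn op) (op a b) = orbit 'P (Inn op) b.
Proof.
apply/orbit_eqP; have -> : op a b = 'P%act b (perm (@op_inj a)).
  by rewrite /= /aperm permE.
apply: mem_orbit; apply: mem_gen; rewrite inE; apply/existsP; exists a.
by apply/forallP => c; rewrite permE.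
Qed.

Definition orbit_closed (Q : {set T}) := forall a b, a \in Q ->
  orbit 'P (Inn op) a = orbit 'P (Inn op) b -> b \in Q.

(** Since [op a] preserves each orbit, both [op a b] and the solution [x] of [op a x = b] lie in the
    orbit of [b], hence in [Q]. *)
Lemma orbit_closed_subrack (Q : {set T}) : orbit_closed Q -> is_subrack op Q.
Proof.
have [_ opD opU] := opR; move=> Qc; split.
- by move=> a b _ bQ; apply: Qc bQ _; rewrite op_orbit.
- by move=> a b c _ _ _; apply: opD; rewrite inE.
move=> a b aQ bQ.
have [x [[_ xE] xU]] := opU a b (finset.in_setT _) (finset.in_setT _).
exists x; split; last by move=> y [_ yE]; apply: xU; rewrite inE.
by split=> //; apply: Qc bQ _; rewrite -xE op_orbit.
Qed.

End RackOrbits.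

Section SubrackComplex.
Context (R : realType) (T : finType) (op : T -> T -> T) (n : nat).
Hypothesis opG : is_G_rack op.
Hypothesis card_orbits : #|rack_orbits op| = n.+1.

Definition nth_orbit (i : 'I_n.+1) : {set T} :=
  enum_val (cast_ord (esym card_orbits) i).

Lemma nth_orbitP i : exists x, nth_orbit i = orbit 'P (Inn op) x.
Proof.
by have /imsetP[x _] := enum_valP (cast_ord (esym card_orbits) i); exists x.
Qed.

Lemma nth_orbit_surj x : exists i, nth_orbit i = orbit 'P (Inn op) x.
Proof.
have xO : orbit 'P (Inn op) x \in rack_orbits op by apply: imset_f.
exists (cast_ord card_orbits (enum_rank_in xO (orbit 'P (Inn op) x))).
by rewrite /nth_orbit cast_ordK enum_rankK_in.
Qed.

Lemma mem_nth_orbit x i :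
  (x \in nth_orbit i) = (nth_orbit i == orbit 'P (Inn op) x).
Proof.
have [y ->] := nth_orbitP i; rewrite eq_sym; apply/idP/eqP => [/orbit_eqP//|<-].
exact: orbit_refl.
Qed.

Definition orbits_met (Q : {set T}) : {set 'I_n.+1} :=
  [set i | Q :&: nth_orbit i != finset.set0]%SET.

Definition orbits_union (A : {set 'I_n.+1}) : {set T} :=
  (\bigcup_(i in A) nth_orbit i)%SET.

Lemma orbits_metP (Q : {set T}) i :
  reflect (exists2 x, x \in Q & x \in nth_orbit i) (i \in orbits_met Q).
Proof.
rewrite inE; apply: (iffP (set0Pn _)) => [[x]|[x xQ xi]].
  by rewrite inE => /andP[xQ xi]; exists x.
by exists x; rewrite inE xQ.
Qed.

Lemma orbits_unionK : cancel orbits_union orbits_met.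
Proof.
move=> A; apply/setP => i; apply/orbits_metP/idP => [[x]|iA].
  (* Two listed orbits sharing a point coincide, and the enumeration is injective. *)
  move=> /finset.bigcupP[j jA]; rewrite !mem_nth_orbit => /eqP <- /eqP ij.
  by rewrite -(cast_ord_inj (enum_val_inj ij)) in jA *.
have [x xE] := nth_orbitP i; exists x; last by rewrite mem_nth_orbit xE.
by apply/finset.bigcupP; exists i => //; rewrite mem_nth_orbit xE.
Qed.

Lemma orbits_union_closed A : orbit_closed op (orbits_union A).
Proof.
move=> a b /finset.bigcupP[i iA]; rewrite mem_nth_orbit => ia ab.
by apply/finset.bigcupP; exists i => //; rewrite mem_nth_orbit -ab.
Qed.

Lemma sub_orbits_union (Q : {set T}) : Q \subset orbits_union (orbits_met Q).
Proof.
apply/fintype.subsetP => x xQ; have [i iE] := nth_orbit_surj x.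
have xi : x \in nth_orbit i by rewrite mem_nth_orbit iE.
by apply/finset.bigcupP; exists i => //; apply/orbits_metP; exists x.
Qed.

Lemma orbits_met_nontrivial Q : Q \in proper_subracks op ->
  nontrivial (orbits_met Q).
Proof.
rewrite inE => /and3P[/asboolP Qr /set0Pn[x xQ] QT]; apply/andP; split.
  have [i iE] := nth_orbit_surj x; apply/set0Pn; exists i.
  by apply/orbits_metP; exists x; rewrite ?mem_nth_orbit ?iE.
(* The G-rack property enters here: a subrack meeting every orbit is the whole rack. *)
apply: contraNneq QT => metT; apply/eqP; apply: (proj2 opG) => // O OO.
have [x' _ OE] := imsetP OO; have [i iE] := nth_orbit_surj x'.
have : i \in orbits_met Q by rewrite metT inE.
by rewrite inE iE -OE.
Qed.

Lemma orbits_union_proper A : nontrivial A ->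
  orbits_union A \in proper_subracks op.
Proof.
move=> /andP[A0 AT]; rewrite inE; apply/and3P; split.
- apply/asboolP; apply: (orbit_closed_subrack (proj1 opG)).
  exact: orbits_union_closed.
- apply: contraNneq A0 => UA0; rewrite -(orbits_unionK A) UA0.
  by apply/eqP/setP => i; rewrite !inE finset.set0I eqxx.
apply: contraNneq AT => UAT; rewrite -(orbits_unionK A) UAT.
apply/eqP/setP => i; rewrite [RHS]inE; apply/orbits_metP.
by have [x xE] := nth_orbitP i; exists x; rewrite ?inE// mem_nth_orbit xE.
Qed.

Lemma subrack_complex_sphere : homotopy_equivalent R
  (realization R (subrack_complex op)) (unit_sphere R n).
Proof.
apply: (@order_complex_sphere R _ _ _ n orbits_met orbits_union).
- move=> Q Q' _ _; rewrite Order.SetSubsetOrder.leEsubset => QQ'.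
  apply/fintype.subsetP => i; rewrite !inE; apply: contraNneq => Q'0.
  by rewrite -finset.subset0 -Q'0 finset.setSI.
- move=> A B AB; rewrite Order.SetSubsetOrder.leEsubset; apply/bigcupsP => i iA.
  by apply: finset.bigcup_sup; exact: (fintype.subsetP AB).
- exact: orbits_met_nontrivial.
- exact: orbits_union_proper.
- by move=> A _; exact: orbits_unionK.
- by move=> Q _; rewrite Order.SetSubsetOrder.leEsubset sub_orbits_union.
Qed.

End SubrackComplex.

Theorem theorem4p6 (R : realType) (T : finType) (op : T -> T -> T) (c : nat)
    (hG : is_G_rack op) (hc : #|rack_orbits op| = c) :
  homotopy_equivalent R
    (realization R (subrack_complex op))
    (unit_sphere R c.-1).
Proof.
(* Without orbits the rack is empty and [c.-1] is 0; both spaces are empty, since a point of either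
   would make a zero sum equal to 1. *)
case: c hc => [c0|n]; last exact: subrack_complex_sphere.
have T0 (x : T) : False.
  have : orbit 'P (Inn op) x \in rack_orbits op by apply: imset_f.
  by rewrite (cards0_eq c0) inE.
apply: homotopy_equivalent_empty => [x|y].
  have [_ x1 xP _] := realizationP x; move/eqP: x1.
  rewrite big1 ?(eq_sym _ 1) ?oner_eq0// => Q _; apply/eqP/negPn/negP => /xP.
  by rewrite inE => /and3P[_ /set0Pn[q _] _]; exact: T0 q.
have y1 : \sum_i (set_val y ord0 i) ^+ 2 = 1 :> R := set_valP y.
by move/eqP: y1; rewrite big_ord0 eq_sym oner_eq0.
Qed.
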